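(* Let $K$ be a metric space and let $f:K\to\mathbb{C}$ be a bounded function. Then the following are equivalent. (a) $f\in B_{1/4}(K)$. (b) There exists a sequence $(\varphi_n)$ of simple $D$-functions on $K$ with $\varphi_n\to f$ uniformly and $\sup_n\|\varphi_n\|_D<\infty$. (c) There exists a constant $\lambda<\infty$ such that for every $n\ge 1$ and every sequence $(\varepsilon_i)_{i=1}^n$ of non-negative real numbers, $$\text{if } \operatorname{os}_n(f,(\varepsilon_i))\neq\emptyset,\ \text{ then }\ \sum_{i=1}^n\varepsilon_i\le\lambda. \qquad ( * )$$ Moreover, if $f$ is real-valued (and satisfies these conditions) and $\beta$ is the best (least) constant $\lambda$ satisfying $( * )$ for all $n$ and all sequences $(\varepsilon_i)_{i=1}^n$, then $$\tfrac12\bigl(\|f\|_\infty+\beta\bigr)\le\|f\|_{B_{1/4}}\le\|f\|_\infty+3\beta .$$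
   Context: $D(K)$ is the set of all $f:K\to\mathbb{C}$ of the form $f=(\varphi_1-\varphi_2)+i(\varphi_3-\varphi_4)$ with $\varphi_1,\dots,\varphi_4$ bounded real-valued lower semi-continuous functions on $K$; its members are called $D$-functions. Equivalently, $f\in D(K)$ iff there is a sequence $(\varphi_j)$ of continuous complex-valued functions on $K$ with $\sup_{k\in K}\sum_j|\varphi_j(k)|<\infty$ and $f=\sum_j\varphi_j$ pointwise; $\|f\|_D$ is the infimum of $\sup_{k\in K}\sum_j|\varphi_j(k)|$ over all such sequences. A function is simple if its range is finite; a simple $D$-function is a simple function belonging to $D(K)$. $B_{1/4}(K)$ is the set of all $f:K\to\mathbb{C}$ for which there exist $(f_n)$ in $D(K)$ and $\lambda<\infty$ with $f_n\to f$ uniformly and $\|f_n\|_D\le\lambda$ for all $n$; $\|f\|_{B_{1/4}}$ is the infimum of such $\lambda$ (over all such sequences). $\|\cdot\|_\infty$ is the sup norm. All $\limsup$'s are non-exclusive (the point itself is allowed). For $\varphi:K\to[-\infty,\infty]$, $U\varphi(x)=\limsup_{y\to x}\varphi(y)=\inf_V\sup_{y\in V}\varphi(y)$, the infimum over open neighborhoods $V$ of $x$. For $f$ complex-valued on a metric space, $\underline{\operatorname{osc}}f(x)=\limsup_{y\to x}|f(y)-f(x)|$ and $\operatorname{osc}f=U\,\underline{\operatorname{osc}}f$. For $\varepsilon\ge0$, $\operatorname{os}(f,\varepsilon)=\{x:\operatorname{osc}f(x)\ge\varepsilon\}$. For a sequence $(\varepsilon_i)$ of non-negative numbers, $\operatorname{os}_1(f,(\varepsilon_i))=\operatorname{os}(f,\varepsilon_1)$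 and, with $W=\operatorname{os}_j(f,(\varepsilon_i))$, $\operatorname{os}_{j+1}(f,(\varepsilon_i))=\operatorname{os}(f|W,\varepsilon_{j+1})$, the oscillation of $f|W$ being computed in the metric subspace $W$. *)

(* Defs.v *)
From HB Require Import structures.
From mathcomp Require Import all_boot all_order all_algebra.
From mathcomp Require Import all_classical all_reals all_analysis.
From mathcomp Require Import complex.

Set Implicit Arguments.
Unset Strict Implicit.
Unset Printing Implicit Defensive.

Import Order.TTheory GRing.Theory Num.Theory.
Import numFieldNormedType.Exports.
Import ComplexField.Normc.

Local Open Scope classical_set_scope.
Local Open Scope ring_scope.

(* Complex-valued functions have codomain R[i]^o, which carries the topology
   and the uniformity given by the modulus. The modulus itself is taken in R,
   as normc. All norms below live in \bar R. *)

Section DFunctions.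
Context {R : realType} {K : metricType R}.
Implicit Types (f : K -> R[i]^o) (phi : nat -> K -> R[i]^o).

Definition bounded_lsc (u : K -> R) : Prop :=
  bounded_fun u /\ lower_semicontinuous (EFin \o u).

Definition D_fun : set (K -> R[i]^o) := [set f |
  exists u1 u2 u3 u4 : K -> R,
    [/\ bounded_lsc u1, bounded_lsc u2, bounded_lsc u3, bounded_lsc u4 &
        forall x, f x = ((u1 x - u2 x) +i* (u3 x - u4 x))%C]].

(* A supremum over K of [0, +oo]-valued quantities: 0 is adjoined so that the
   supremum over an empty K is 0 rather than -oo. *)
Definition esup0 (g : K -> \bar R) : \bar R :=
  ereal_sup ([set 0%E] `|` range g).

Definition sup_norm f : \bar R := esup0 (fun x => (normc (f x))%:E).

Definition abs_series_sup phi : \bar R :=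
  esup0 (fun x => (\sum_(0 <= j <oo) (normc (phi j x))%:E)%E).

Definition D_norm f : \bar R :=
  ereal_inf [set abs_series_sup phi | phi in [set phi |
    [/\ forall j, continuous (phi j),
        (abs_series_sup phi < +oo)%E &
        forall x, series (phi^~ x) @ \oo --> f x]]].

Definition simple_D_fun : set (K -> R[i]^o) :=
  [set f | D_fun f /\ finite_set (range f)].

Definition B14_bound f (lambda : R) : Prop :=
  exists g : nat -> K -> R[i]^o,
    [/\ forall n, D_fun (g n),
        {uniform, g @ \oo --> f} &
        forall n, (D_norm (g n) <= lambda%:E)%E].

Definition B14 : set (K -> R[i]^o) := [set f | exists lambda, B14_bound f lambda].

Definition B14_norm f : \bar R :=
  ereal_inf [set lambda%:E | lambda in [set lambda | B14_bound f lambda]].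

End DFunctions.

Section Oscillation.
Context {R : realType} {K : metricType R}.
Implicit Types (f : K -> R[i]^o) (W : set K).

(* For x in W, the sets V `&` W with V an open neighbourhood of x in K are the
   open neighbourhoods of x in the metric subspace W. Hence, at points of W,
   [U_env W g], [losc f W] and [osc f W] are the upper envelope of g|W and the
   oscillations of f|W computed in W; W = setT gives those on K. *)
Definition U_env W (g : K -> \bar R) (x : K) : \bar R :=
  ereal_inf [set ereal_sup (g @` (V `&` W)) | V in open_nbhs x].

Definition losc f W (x : K) : \bar R :=
  U_env W (fun y => (normc (f y - f x))%:E) x.

Definition osc f W : K -> \bar R := U_env W (losc f W).

Definition os f W (eps : R) : set K := [set x | W x /\ (eps%:E <= osc f W x)%E].

(* Indexed from 1 (eps 0 is unused), with os_iter f eps 0 = K. *)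
Fixpoint os_iter f (eps : nat -> R) (n : nat) : set K :=
  if n is m.+1 then os f (os_iter f eps m) (eps m.+1) else setT.

Definition osc_bound f (lambda : R) : Prop :=
  forall (n : nat) (eps : nat -> R), (1 <= n)%N ->
    (forall i, (1 <= i <= n)%N -> 0 <= eps i) ->
    os_iter f eps n !=set0 -> \sum_(1 <= i < n.+1) eps i <= lambda.

End Oscillation.

(* Main.v *)
Require Import Defs.
From HB Require Import structures.
From mathcomp Require Import all_boot all_order all_algebra.
From mathcomp Require Import all_classical all_reals all_analysis.
From mathcomp Require Import complex.
From mathcomp Require Import ring lra.

Set Implicit Arguments.
Unset Strict Implicit.
Unset Printing Implicit Defensive.

Import Order.TTheory GRing.Theory Num.Theory.
Import numFieldNormedType.Exports.
Import ComplexField.Normc.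

Local Open Scope classical_set_scope.
Local Open Scope ring_scope.

(* Lower estimate: if [g] is the pointwise sum of continuous [phi j], each
   further step of the iterated oscillation sets of [g] forces a disjoint block
   of the series [\sum_j |phi j|] to be at least the prescribed oscillation, at
   points arbitrarily close by. Hence [osc_bound g (D_norm g)], and this passes
   to uniform limits.

   Upper estimate: for a mesh [d], let [u x] be the largest total [\sum_i eps i]
   with [x] in [os_iter f eps n] and all [eps i] multiples of [d]. Then
   [0 <= u <= beta], and [u y + |f y - f x| <= u x + d] for [y] near [x], because
   only finitely many (closed) iterated oscillation sets occur. For real [f] the
   functions [(|f|_oo + beta - u + f) / 2] and [(|f|_oo + beta - u - f) / 2] are
   nonnegative, lower semicontinuous up to [d], differ by [f] and add up to at
   most [|f|_oo + beta]. Rounding their lower envelopes to multiples of a mesh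
   yields simple D-functions near [f], whence the estimate
   [B14_norm f <= |f|_oo + beta], better than the one required. *)

(** * The real modulus on [R[i]] and convergence expressed through it *)

Section Modulus.
Context {R : realType}.
Implicit Types z w : R[i].

Lemma normr_normc z : `|z| = (normc z)%:C%C.
Proof. by []. Qed.

Lemma normc_ge0 z : 0 <= normc z.
Proof. by case: z => a b; exact: sqrtr_ge0. Qed.

Lemma normcD z w : normc (z + w) <= normc z + normc w.
Proof. exact: le_normcD. Qed.

Lemma normcB z w : normc (z - w) = normc (w - z).
Proof. by rewrite -opprB; exact: normcN. Qed.

Lemma normc_triangle (v z w : R[i]) :
  normc (z - w) <= normc (z - v) + normc (v - w).
Proof. by apply: le_trans (normcD _ _); rewrite addrA subrK. Qed.

Lemma normc_Re z : `|complex.Re z| <= normc z.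
Proof. by rewrite -lecR; exact: normc_ge_Re. Qed.

Lemma normc_Im z : `|complex.Im z| <= normc z.
Proof.
case: z => a b /=; rewrite -sqrtr_sqr ler_wsqrtr// lerDr; exact: sqr_ge0.
Qed.

Lemma normc_le z : normc z <= `|complex.Re z| + `|complex.Im z|.
Proof.
case: z => a b /=; have s0 : 0 <= `|a| + `|b| by rewrite addr_ge0.
rewrite -[leRHS]ger0_norm// -[leRHS]sqrtr_sqr ler_wsqrtr// sqrrD.
rewrite !real_normK ?num_real//.
by rewrite addrAC lerDl mulrn_wge0// mulr_ge0.
Qed.

Lemma normc_sub_le z (b c : R) :
  normc (z - (b +i* c)%C) <= `|complex.Re z - b| + `|complex.Im z - c|.
Proof. by case: z => x y; exact: normc_le. Qed.

Lemma normc_sum (I : Type) (s : seq I) (F : I -> R[i]) :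
  normc (\sum_(i <- s) F i) <= \sum_(i <- s) normc (F i).
Proof.
elim/big_ind2 : _ => [|a b c d ab cd|//]; first by rewrite normc0.
by apply: (le_trans (normcD _ _)); apply: lerD.
Qed.

Lemma cvg_normcP (T : Type) (F : set_system T) {FF : Filter F}
    (h : T -> R[i]^o) (l : R[i]^o) :
  h @ F --> l <->
  forall e : R, 0 < e -> \forall t \near F, normc (l - h t) < e.
Proof.
split=> [/cvgrPdist_lt hl e e0|hl].
  by apply: filterS (hl e%:C%C _) => [t|]; rewrite ?ltcR// normr_normc ltcR.
(* A positive element of [R[i]] has zero imaginary part, so real radii suffice. *)
apply/cvgrPdist_lt => -[a b]; rewrite ltcE/= => /andP[/eqP -> /hl]/=.
by apply: filterS => t; rewrite normr_normc ltcR.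
Qed.

Lemma uniform_normcP (K : metricType R) (f : K -> R[i]^o)
  (g : nat -> K -> R[i]^o) :
  {uniform, g @ \oo --> f} <->
  forall e : R, 0 < e -> \forall n \near \oo, forall x, normc (f x - g n x) < e.
Proof.
rewrite uniform_nbhsT.
split=> [/(@cvg_ballP _ (arrow_uniform_type K R[i]^o)) fg e e0|fg].
  have /fg : 0 < e%:C%C by rewrite ltcR.
  by apply: filterS => n gn x; have := gn x; rewrite /ball/= normr_normc ltcR.
apply/(@cvg_ballP _ (arrow_uniform_type K R[i]^o)) => -[a b].
rewrite ltcE/= => /andP[/eqP -> /fg]/=.
by apply: filterS => n gn x; have := gn x; rewrite /ball/= normr_normc ltcR.
Qed.

End Modulus.

(** * Upper envelopes and oscillation sets *)

Section Os.
Context {R : realType} {K : metricType R}.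
Implicit Types (f : K -> R[i]^o) (W : set K) (e : R).

Lemma lt_near_U_env W (g : K -> \bar R) x (e : \bar R) : (U_env W g x < e)%E ->
  \forall y \near x, W y -> (g y < e)%E.
Proof.
move=> /ereal_inf_lt[_ [V xV <-]] Vlt; rewrite open_nbhsE in xV.
apply: filterS xV.2 => y Vy Wy; apply: le_lt_trans Vlt.
by apply: ereal_sup_ubound; exists y.
Qed.

(** Upper semicontinuity of the envelope: the open set witnessing the bound at [x] is a
    neighbourhood of each of its points and witnesses the same bound there. *)
Lemma U_env_lt_near W (g : K -> \bar R) x (e : \bar R) : (U_env W g x < e)%E ->
  \forall y \near x, (U_env W g y < e)%E.
Proof.
move=> /ereal_inf_lt[_ [V xV <-]] Vlt; rewrite open_nbhsE in xV.
apply: filterS xV.2 => y Vy; apply: le_lt_trans Vlt.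
apply: ereal_inf_lbound; exists V => //.
by split; [exact: xV.1|].
Qed.

Lemma le_U_env W (g : K -> \bar R) x : W x -> (g x <= U_env W g x)%E.
Proof.
move=> Wx; rewrite leNgt; apply/negP => /lt_near_U_env /nbhs_singleton /(_ Wx).
by rewrite ltxx.
Qed.

Lemma lt_U_env W (g : K -> \bar R) x (e : \bar R) V : nbhs x V ->
  (e < U_env W g x)%E -> exists y, [/\ V y, W y & (e < g y)%E].
Proof.
rewrite nbhsE => -[Q xQ QV] egx.
have : (e < ereal_sup (g @` (Q `&` W)))%E.
  by apply: lt_le_trans egx _; apply: ereal_inf_lbound; exists Q.
move=> /ereal_sup_gt[_ [y [Qy Wy] <-] ey]; exists y; split => //; exact: QV.
Qed.

Lemma osc_near f W x e : W x -> ~ os f W e x ->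
  \forall y \near x, W y -> normc (f y - f x) < e.
Proof.
move=> Wx nos; have {}nos : (osc f W x < e%:E)%E.
  by rewrite ltNge; apply/negP => h; apply: nos.
exact: (lt_near_U_env (le_lt_trans (le_U_env _ Wx) nos)).
Qed.

(** Closedness is phrased through complements so that it can be iterated: off [W] use the
    hypothesis, on [W] the upper semicontinuity of [osc f W]. *)
Lemma os_closed f W e x : (~ W x -> \forall y \near x, ~ W y) -> ~ os f W e x ->
  \forall y \near x, ~ os f W e y.
Proof.
move=> clW nos; have [Wx|/clW] := pselect (W x); last first.
  by apply: filterS => y Wy [].
have {}nos : (osc f W x < e%:E)%E.
  by rewrite ltNge; apply/negP => h; apply: nos.
apply: filterS (U_env_lt_near nos) => y oy [_].
by rewrite leNgt oy.
Qed.

(** The two nested limits superior unfolded: [V'] may be chosen once [y] is known, which is what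
    lets a partial sum be fixed between [y] and [z]. *)
Lemma os_gt f W e x V (d : R) : os f W e x -> nbhs x V -> 0 < d ->
  exists y, [/\ V y, W y & forall V', nbhs y V' ->
    exists z, [/\ V' z, W z & e - d < normc (f z - f y)]].
Proof.
move=> [Wx eo] xV d0.
have : ((e - d)%:E < osc f W x)%E.
  by apply: lt_le_trans eo; rewrite lte_fin ltrBlDr ltrDl.
move=> /(lt_U_env xV)[y [Vy Wy ey]]; exists y; split => // V' yV'.
have [z [V'z Wz ez]] := lt_U_env yV' ey.
by exists z; split.
Qed.

Lemma os_intro f W e x : W x ->
  (forall V (d : R), open_nbhs x V -> 0 < d ->
    exists y, [/\ V y, W y & forall V', open_nbhs y V' ->
    exists z, [/\ V' z, W z & e - d <= normc (f z - f y)]]) -> os f W e x.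
Proof.
move=> Wx h; split => //; apply/lee_addgt0Pr => d d0.
rewrite -leeBlDr//; apply: le_ereal_inf_tmp => _ [V xV <-].
have [y [Vy Wy hy]] := h _ _ xV d0.
apply: (@le_trans _ _ (losc f W y)); last by apply: ereal_sup_ubound; exists y.
apply: le_ereal_inf_tmp => _ [V' yV' <-].
have [z [Vz Wz hz]] := hy _ yV'.
apply: (@le_trans _ _ (normc (f z - f y))%:E); first by rewrite -EFinB lee_fin.
by apply: ereal_sup_ubound; exists z.
Qed.

(** Covers at once a larger set and a perturbed function, the two changes met at each stage of
    [os_iter_close]. *)
Lemma os_le f g W W' e e' x : W `<=` W' ->
  (forall y z, e' - normc (g z - g y) <= e - normc (f z - f y)) ->
  os f W e x -> os g W' e' x.
Proof.
move=> WW' fg ox; apply: os_intro => [|V d [Vo Vx] d0]; first by apply: WW'; case: ox.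
have [y [Vy Wy hy]] := os_gt ox (open_nbhs_nbhs (conj Vo Vx)) d0.
exists y; split => //; first exact: WW'.
move=> V' /open_nbhs_nbhs/hy[z [V'z Wz ez]]; exists z; split => //; first exact: WW'.
have := fg y z; lra.
Qed.

Lemma os0 f W : os f W 0 = W.
Proof.
apply/seteqP; split => [x []//|x Wx].
apply: os_intro => // V d [_ Vx] d0; exists x; split => // V' [_ V'x].
by exists x; split => //; rewrite subrr normc0 sub0r oppr_le0 ltW.
Qed.

Lemma os_iter_eq f (eps eps' : nat -> R) n :
  (forall i, (1 <= i <= n)%N -> eps i = eps' i) ->
  os_iter f eps n = os_iter f eps' n.
Proof.
elim: n => [//|n ih h /=]; rewrite ih => [|i /andP[i1 i2]].
  by rewrite h// leqnn.
by rewrite h// i1/= leqW.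
Qed.

Lemma osc_bound_ge0 f lambda (x : K) : osc_bound f lambda -> 0 <= lambda.
Proof.
move=> /(_ 1%N (fun=> 0)); rewrite big_nat1; apply => //.
by exists x; rewrite /= os0.
Qed.

End Os.

(** * Series of continuous functions along iterated oscillation sets *)

Lemma continuous_sum_nat (F : numFieldType) (V : normedModType F)
  (T : topologicalType) (h : nat -> T -> V) (m n : nat) :
  (forall j, continuous (h j)) ->
  continuous (fun x => \sum_(m <= j < n) h j x).
Proof. by move=> ch; apply: (continuous_big add_continuous). Qed.

Section DSeries.
Context {R : realType} {K : metricType R}.
Implicit Types (f g : K -> R[i]^o) (phi : nat -> K -> R[i]^o).

Lemma normc_continuous (T : topologicalType) (h : T -> R[i]^o) :
  continuous h -> continuous (fun x => normc (h x)).
Proof.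
move=> ch x; apply/cvgrPdist_lt => e e0.
have /cvg_normcP/(_ e e0) := ch x; apply: filterS => y; apply: le_lt_trans.
have := normcD (h x - h y) (h y); have := normcD (h y - h x) (h x).
by rewrite !subrK (normcB (h y)) ler_norml => ? ?; apply/andP; split; lra.
Qed.

Lemma nneseries_le (a : nat -> R) (M : R) : (forall j, 0 <= a j) ->
  (\sum_(0 <= j <oo) (a j)%:E <= M%:E)%E <->
  forall n, \sum_(0 <= j < n) a j <= M.
Proof.
move=> a0; split=> [h n|h].
  rewrite -lee_fin -sumEFin; apply: le_trans h; apply: nneseries_lim_ge => j _ _.
  by rewrite lee_fin.
apply: lime_le; first by apply: is_cvg_nneseries => j _ _; rewrite lee_fin.
by near=> n; rewrite sumEFin lee_fin.
Unshelve. all: by end_near. Qed.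

Lemma esup0_le (g : K -> \bar R) (M : R) :
  (esup0 g <= M%:E)%E <-> 0 <= M /\ forall x, (g x <= M%:E)%E.
Proof.
split=> [h|[M0 h]].
  split; first by rewrite -lee_fin; apply: le_trans h; apply: ereal_sup_ubound; left.
  by move=> x; apply: le_trans h; apply: ereal_sup_ubound; right; exists x.
by apply: ge_ereal_sup => _ [->|[x _ <-]].
Qed.

Lemma D_norm_series g (M d : R) : (D_norm g <= M%:E)%E -> 0 < d ->
  exists phi, [/\ forall j, continuous (phi j),
    forall n x, \sum_(0 <= j < n) normc (phi j x) <= M + d &
    forall x, series (phi^~ x) @ \oo --> g x].
Proof.
move=> gM d0; have : (D_norm g < (M + d)%:E)%E.
  by apply: le_lt_trans gM _; rewrite lte_fin ltrDl.
move=> /ereal_inf_lt[_ [phi [cphi _ gphi] <-]] /ltW/esup0_le[_ phiM].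
exists phi; split => // n x; move: n.
by apply/nneseries_le => // j; exact: normc_ge0.
Qed.

Lemma D_norm_ge0 g : (0 <= D_norm g)%E.
Proof.
apply: le_ereal_inf_tmp => _ [phi _ <-].
by apply: ereal_sup_ubound; left.
Qed.

(** Induction on [n], peeling off the level applied last. An oscillation of [g] between [y] and [z]
    must come from a block of terms at [z]; continuity of the block keeps it large near [z], where
    the induction hypothesis is applied beyond the block. The free starting index [m] keeps the
    blocks disjoint. *)
Lemma os_iter_series_tail phi g n eps x (V : set K) d m :
  (forall j, continuous (phi j)) ->
  (forall x, series (phi^~ x) @ \oo --> g x) ->
  os_iter g eps n x -> nbhs x V -> 0 < d ->
  exists w N, [/\ V w, (m <= N)%N &
    \sum_(1 <= i < n.+1) eps i - d <= \sum_(m <= j < N) normc (phi j w)].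
Proof.
move=> cphi phig; have Scont N : continuous (fun x => series (phi^~ x) N).
  exact: (@continuous_sum_nat _ R[i]^o).
elim: n x V d m => [|n ih] x V d m.
  move=> _ xV d0; exists x, m; split => //; first exact: nbhs_singleton.
  by rewrite !big_geq// sub0r oppr_le0 ltW.
(* The block loses [4 * c] and the induction hypothesis another [c], which stays below [d]. *)
move=> ox xV d0; pose c := d / 6; have c0 : 0 < c by rewrite divr_gt0.
(* [V] is replaced by the set of points of which it is a neighbourhood, so that it can still be used
   at [y] and [z]. *)
have [y [yV Wy hy]] := os_gt ox (near_join xV) c0.
(* Order of choices: [N] depends on [y], then [z] is taken so close to [y] that the partial sums up
   to [N] agree up to [c], and [N'] depends on [z]. *)
have [N [mN gN]] : exists N, (m <= N)%N /\ normc (g y - series (phi^~ y) N) < c.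
  near \oo => N; exists N; split; near: N; first exact: nbhs_infty_ge.
  by have /cvg_normcP := phig y; exact.
have V'y : nbhs y
    [set z | nbhs z V /\ normc (series (phi^~ y) N - series (phi^~ z) N) < c].
  by apply: filterI; [exact: near_join|have /cvg_normcP := Scont N y; exact].
have [z [[zV SN] Wz ez]] := hy _ V'y.
have [N' [NN' gN']] : exists N', (N <= N')%N /\ normc (g z - series (phi^~ z) N') < c.
  near \oo => N'; exists N'; split; near: N'; first exact: nbhs_infty_ge.
  by have /cvg_normcP := phig z; exact.
have zN' : eps n.+1 - 4 * c < \sum_(N <= j < N') normc (phi j z).
  have S : normc (series (phi^~ z) N' - series (phi^~ z) N) <=
      \sum_(N <= j < N') normc (phi j z).
    by rewrite sub_series_geq//; exact: normc_sum.
  have := normc_triangle (series (phi^~ z) N') (g z) (g y).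
  have := normc_triangle (series (phi^~ z) N) (series (phi^~ z) N') (g y).
  have := normc_triangle (series (phi^~ y) N) (series (phi^~ z) N) (g y).
  rewrite (normcB _ (g y)) in gN *.
  rewrite (normcB (series (phi^~ y) N)) in SN.
  rewrite (normcB (series (phi^~ y) N) (g y)).
  lra.
have V''z : nbhs z
    [set t | V t /\ eps n.+1 - 4 * c < \sum_(N <= j < N') normc (phi j t)].
  apply: filterI => //.
  have sc : continuous (fun x => \sum_(N <= j < N') normc (phi j x)).
    exact: (@continuous_sum_nat R R^o K (fun j x => normc (phi j x)) N N'
      (fun j => normc_continuous (cphi j))).
  pose gap := \sum_(N <= j < N') normc (phi j z) - (eps n.+1 - 4 * c).
  have /cvgrPdist_lt/(_ gap) := sc z.
  rewrite /gap subr_gt0 => /(_ zN'); apply: filterS => t.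
  by rewrite ltr_norml => /andP[_]; lra.
have [w [N'' [[Vw ew] N'N'' le]]] := ih z _ c N' Wz V''z c0.
exists w, N''; split => //; first exact: leq_trans (leq_trans NN' N'N'').
rewrite big_nat_recr//= (big_cat_nat mN (leq_trans NN' N'N''))/=.
rewrite (big_cat_nat NN' N'N'')/=.
have s0 : 0 <= \sum_(m <= j < N) normc (phi j w).
  by apply: sumr_ge0 => j _; exact: normc_ge0.
rewrite /c in le ew; lra.
Unshelve. all: by end_near. Qed.

End DSeries.

(** * Oscillation and modulus bounded by the norms *)

Section LowerBound.
Context {R : realType} {K : metricType R}.
Implicit Types (f g : K -> R[i]^o).

Lemma D_norm_os_iter g (M : R) n eps x : (D_norm g <= M%:E)%E ->
  os_iter g eps n x -> \sum_(1 <= i < n.+1) eps i <= M.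
Proof.
move=> gM ox; apply/ler_addgt0Pr => d d0.
have d20 : 0 < d / 2 by rewrite divr_gt0.
have [phi [cphi phiM phig]] := D_norm_series gM d20.
have [w [N [_ _]]] := os_iter_series_tail 0 cphi phig ox filterT d20.
have := phiM N w; lra.
Qed.

Lemma normc_le_D_norm g (M : R) x : (D_norm g <= M%:E)%E -> normc (g x) <= M.
Proof.
move=> gM; apply/ler_addgt0Pr => d d0.
have d20 : 0 < d / 2 by rewrite divr_gt0.
have [phi [_ phiM phig]] := D_norm_series gM d20.
have /cvg_normcP/(_ _ d20)[N _ /(_ _ (leqnn N))/=] := phig x.
have := normcD (g x - series (phi^~ x) N) (series (phi^~ x) N).
rewrite subrK; have := normc_sum (index_iota 0 N) (phi^~ x).
have := phiM N x; rewrite /series /=; lra.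
Qed.

(** Moving both values by at most [r] changes a difference by at most [2 * r]. Lowered levels may be
    negative, which is why [D_norm_os_iter] takes arbitrary real levels. *)
Lemma os_iter_close f g (r : R) eps n : (forall x, normc (f x - g x) <= r) ->
  os_iter f eps n `<=` os_iter g (fun i => eps i - 2 * r) n.
Proof.
move=> fg; elim: n => //= n ih x; apply: os_le => // y z.
have := normc_triangle (g z) (f z) (f y).
have := normc_triangle (g y) (g z) (f y).
have := fg z; have := fg y; rewrite (normcB (g y)); lra.
Qed.

Lemma B14_bound_osc_bound f (lambda : R) : B14_bound f lambda -> osc_bound f lambda.
Proof.
move=> [g [_ /uniform_normcP gf glambda]] n eps _ _ [x ox].
apply/ler_addgt0Pr => d d0.
(* Each of the [n] levels loses twice this radius, in total [d * n / (n + 1)], at most [d]. *)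
have r0 : 0 < d / (2 * n.+1%:R) by rewrite divr_gt0// mulr_gt0.
have [k _ /(_ _ (leqnn k))/= fgk] := gf _ r0.
have := D_norm_os_iter (glambda k) (os_iter_close (fun x => ltW (fgk x)) ox).
rewrite sumrB sumr_const_nat subSS subn0 -mulr_natr lerBlDr => /le_trans; apply.
rewrite lerD2l.
have n0 : n.+1%:R != 0 :> R by rewrite pnatr_eq0.
rewrite [leLHS](_ : _ = d * (n%:R / n.+1%:R)); last by field.
by rewrite ler_piMr ?(ltW d0)// ler_pdivrMr// mul1r ler_nat.
Qed.

Lemma B14_bound_normc f (lambda : R) x : B14_bound f lambda -> normc (f x) <= lambda.
Proof.
move=> [g [_ /uniform_normcP gf glambda]]; apply/ler_addgt0Pr => d d0.
have [k _ /(_ _ (leqnn k))/(_ x)/=] := gf _ d0.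
have := normc_le_D_norm x (glambda k).
have := normcD (f x - g k x) (g k x); rewrite subrK; lra.
Qed.

Lemma B14_bound_ge0 f (lambda : R) : B14_bound f lambda -> 0 <= lambda.
Proof.
move=> [g [_ _ /(_ 0)]] h; rewrite -lee_fin; apply: le_trans h; exact: D_norm_ge0.
Qed.

End LowerBound.

(** * Oscillation levels on a grid and the potential [u] *)

Section Grid.
Context {R : realType} {K : metricType R}.
Implicit Types (f : K -> R[i]^o) (s : seq nat).

(* The head of [s] is the oscillation level applied last. *)
Definition os_grid f (d : R) s : set K :=
  foldr (fun j W => os f W (d *+ j)) setT s.

Lemma os_grid_closed f d s x : ~ os_grid f d s x ->
  \forall y \near x, ~ os_grid f d s y.
Proof.
elim: s x => [|j s ih] x /=; first by move=> /(_ I).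
exact: os_closed (ih x).
Qed.

Lemma os_grid_iter f d s : exists eps : nat -> R,
  [/\ forall i, (1 <= i <= size s)%N -> exists j, eps i = d *+ j,
      os_iter f eps (size s) = os_grid f d s &
      \sum_(1 <= i < (size s).+1) eps i = d *+ sumn s].
Proof.
elim: s => [|j s [eps [epsd epsi epss]]].
  by exists (fun=> 0); split => //=; rewrite ?big_geq// => -[].
pose eps' i := if i == (size s).+1 then d *+ j else eps i.
have eps'E i : (1 <= i <= size s)%N -> eps' i = eps i.
  by move=> /andP[_ i_s]; rewrite /eps' ltn_eqF.
exists eps'; split => /=.
- move=> i /andP[i1]; rewrite leq_eqVlt => /orP[/eqP ->|i_s].
    by exists j; rewrite /eps' eqxx.
  by rewrite eps'E ?i1//; apply: epsd; rewrite i1.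
- by rewrite (os_iter_eq _ eps'E) epsi /eps' eqxx.
- rewrite big_nat_recr//= {2}/eps' eqxx mulrnDr addrC -epss; congr (_ + _).
  by rewrite big_nat [RHS]big_nat; apply: eq_bigr => i; rewrite ltnS; exact: eps'E.
Qed.

Lemma osc_bound_os_grid f (lambda d : R) s x : osc_bound f lambda -> 0 <= d ->
  os_grid f d s x -> d *+ sumn s <= lambda.
Proof.
move=> fl d0; case: s => [|j s] ox.
  by rewrite mulr0n; exact: (osc_bound_ge0 x fl).
have [eps [epsd epsi <-]] := os_grid_iter f d (j :: s).
apply: fl; first by [].
  by move=> i /epsd[k ->]; exact: mulrn_wge0.
by rewrite epsi; exists x.
Qed.

(** A finite supply of lists, so that the neighbourhoods attached to them can be intersected. Zero
    levels are left out: this bounds the length of a list by its sum. *)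
Fixpoint grid_seqs (N m : nat) : seq (seq nat) :=
  if m is m'.+1 then [::] :: [seq j :: s | j <- iota 1 N, s <- grid_seqs N m']
  else [:: [::]].

Lemma mem_grid_seqs N m s :
  (s \in grid_seqs N m) = (size s <= m)%N && all (fun j => 1 <= j <= N)%N s.
Proof.
elim: m s => [|m ih] [|j s] //=.
rewrite inE /=; apply/allpairsP/idP => [[[k t] /= [kN tm [-> ->]]]|].
  move: kN tm; rewrite mem_iota ih add1n ltnS => -> /andP[]; rewrite ltnS => -> ->.
  by [].
rewrite ltnS => /and3P[sm jN sN]; exists (j, s); split => //=.
  by rewrite mem_iota add1n ltnS.
by rewrite ih sm.
Qed.

Lemma near_mem_all (T : eqType) (F : set_system K) {FF : Filter F}
    (l : seq T) (P : T -> K -> Prop) :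
  (forall t, t \in l -> \forall y \near F, P t y) ->
  \forall y \near F, forall t, t \in l -> P t y.
Proof.
elim: l => [_|t l ih h]; first exact: nearW.
have ht := h t (mem_head _ _).
have {}ih := ih (fun t' tl => h t' (mem_behead (s := t :: l) tl)).
by apply: filterS2 ht ih => y Pt Pl t'; rewrite inE => /orP[/eqP ->|/Pl].
Qed.

(** A list [s] optimal at [y] near [x] is admissible at [x] by closedness. If the jump from [x] to
    [y] is at least [d *+ t] with [t] positive, [t :: s] is admissible at [x] as well, since
    otherwise [osc_near] would forbid that jump. Rounding the jump down to the grid costs one
    [d]. *)
Lemma oscillation_potential f (beta d : R) : osc_bound f beta -> 0 < d ->
  exists u : K -> R, forall x, 0 <= u x <= beta /\
    \forall y \near x, u y + normc (f y - f x) <= u x + d.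
Proof.
(* Every admissible list has sum below [N]; with positive entries, [N] then bounds its length and
   its entries too. *)
move=> fb d0; pose N := (Num.truncn (beta / d)).+1.
have sumnN s x : os_grid f d s x -> (sumn s < N)%N.
  move=> sx; have := osc_bound_os_grid fb (ltW d0) sx.
  rewrite -mulr_natr mulrC -ler_pdivlMr// ltnS => sb.
  by rewrite truncn_ge_nat ?(le_trans _ sb).
pose U x : set nat :=
  [set n | exists2 s, s \in grid_seqs N N & os_grid f d s x /\ sumn s = n].
have exU x : exists n, `[< U x n >].
  by exists 0%N; apply/asboolP; exists [::] => //; rewrite mem_grid_seqs.
have ubU x n : `[< U x n >] -> (n <= N)%N.
  by move=> /asboolP[s _ [sx <-]]; exact: ltnW (sumnN _ _ sx).
pose v x := ex_maxn (exU x) (ubU x).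
have vU x : U x (v x) by rewrite /v; case: ex_maxnP => n /asboolP.
have Uv x n : U x n -> (n <= v x)%N.
  by rewrite /v; case: ex_maxnP => m _ h Un; apply: h; apply/asboolP.
exists (fun x => d *+ v x) => x; split.
  rewrite mulrn_wge0 ?(ltW d0) //; have [s _ [sx <-]] := vU x.
  exact: (osc_bound_os_grid fb (ltW d0) sx).
have near1 : \forall y \near x, forall s, s \in grid_seqs N N ->
    os_grid f d s y -> os_grid f d s x.
  apply: near_mem_all => s _; have [sx|/os_grid_closed] := pselect (os_grid f d s x).
    exact: nearW.
  exact: filterS.
have near2 : \forall y \near x, forall t,
    t \in [seq (s, j) | s <- grid_seqs N N, j <- iota 1 N] ->
    os_grid f d t.1 y -> os_grid f d t.1 x -> d *+ t.2 <= normc (f y - f x) ->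
    os_grid f d (t.2 :: t.1) x.
  apply: near_mem_all => -[s j] _ /=.
  have [sx|nsx] := pselect (os_grid f d s x); last exact: nearW.
  have [ox|nox] := pselect (os f (os_grid f d s) (d *+ j) x); first exact: nearW.
  by apply: filterS (osc_near sx nox) => y /[apply]; rewrite ltNge => /negP.
apply: filterS2 near1 near2 => y h1 h2.
have [s sN [sy <-]] := vU y; have sx := h1 _ sN sy.
pose t := Num.truncn (normc (f y - f x) / d).
have t_itv : d *+ t <= normc (f y - f x) < d *+ t.+1.
  have := truncn_itv (divr_ge0 (normc_ge0 (f y - f x)) (ltW d0)).
  by rewrite ler_pdivlMr// ltr_pdivrMr// !mulr_natl.
have step j : (1 <= j <= N)%N -> d *+ j <= normc (f y - f x) -> os_grid f d (j :: s) x.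
  move=> jN; apply: (h2 (s, j)) => //; apply: allpairs_f => //.
  by rewrite mem_iota add1n ltnS.
(* [near2] only reaches levels up to [N]. A larger jump would make level [N] itself admissible,
   against [sumnN]. *)
have tN : (t <= N)%N.
  rewrite leqNgt; apply/negP => Nt.
  have /sumnN/= : os_grid f d (N :: s) x.
    apply: step; rewrite ?leqnn//; case/andP: t_itv => + _; apply: le_trans.
    by apply: ler_wpMn2l; rewrite ?ltW// ltnW.
  by rewrite ltnNge leq_addr.
suff st : (sumn s + t <= v x)%N.
  have : d *+ (sumn s + t) <= d *+ v x by apply: ler_wpMn2l st; exact: ltW.
  case/andP: t_itv => _; rewrite mulrSr mulrnDr; lra.
(* A zero entry is not allowed in [grid_seqs], so for [t = 0] the list [s] itself is used. *)
have [t0|t0] := posnP t.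
  by rewrite t0 addn0; apply: Uv; exists s.
have tx : os_grid f d (t :: s) x.
  by apply: step; rewrite ?t0//; case/andP: t_itv.
rewrite addnC; apply: Uv; exists (t :: s) => //.
move: sN (sumnN _ _ tx); rewrite !mem_grid_seqs => /andP[_ sN] /= ts.
have ss : (size s <= sumn s)%N.
  elim: s sN {sy sx h1 h2 step tx ts} => //= a s ih /andP[/andP[a1 _] /ih].
  by move=> ss; rewrite -add1n leq_add.
apply/andP; split; last by rewrite t0 tN.
exact: leq_ltn_trans (leq_trans ss (leq_addl t _)) ts.
Qed.

End Grid.

(** * Lower semicontinuous functions as monotone limits, and the resulting bound on [D_norm] *)

Section Semicontinuous.
Context {R : realType} {K : metricType R}.
Implicit Types (a : K -> R) (g : K -> R[i]^o).

Lemma lsc_near a x e : lower_semicontinuous (EFin \o a) -> 0 < e ->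
  \forall y \near x, a x - e < a y.
Proof.
move=> /(_ x (a x - e)); rewrite lte_fin ltrBlDr ltrDl => /[apply].
by move=> [V xV Va]; apply: filterS xV => y /Va; rewrite lte_fin.
Qed.

(** Baire's regularization: [G n] is the infimal convolution of [a] with [n] times the distance,
    hence [n]-Lipschitz and increasing in [n]. The zero function is put in front so that the
    increments add up to [a]. *)
Lemma lsc_sup_continuous a : (forall x, 0 <= a x) ->
  lower_semicontinuous (EFin \o a) -> exists F : nat -> K -> R,
  [/\ forall x, F 0%N x = 0, forall n, continuous (F n),
      forall n x, F n x <= F n.+1 x, forall n x, F n x <= a x &
      forall x, F n x @[n --> \oo] --> a x].
Proof.
move=> a0 lsca.
pose S n x : set R := range (fun y => a y + n%:R * mdist x y).
pose G n x := inf (S n x).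
have Slb n x : lbound (S n x) 0.
  by move=> _ [y _ <-]; rewrite addr_ge0// mulr_ge0// mdist_ge0.
have Gle n x y : G n x <= a y + n%:R * mdist x y.
  by apply: ge_inf; [exists 0; exact: Slb|exists y].
have leG n x t : (forall y, t <= a y + n%:R * mdist x y) -> t <= G n x.
  move=> h; apply: lb_le_inf; first by exists (a x + n%:R * mdist x x), x.
  by move=> _ [y _ <-].
have Glip n x y : G n x - n%:R * mdist x y <= G n y.
  apply: leG => z; have := Gle n x z.
  have : n%:R * mdist x z <= n%:R * (mdist x y + mdist y z).
    by rewrite ler_wpM2l// metric_triangle.
  rewrite mulrDr; lra.
have Ga n x : G n x <= a x by have := Gle n x x; rewrite mdistxx mulr0 addr0.
exists (fun n => if n is m.+1 then G m else fun=> 0); split => //.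
- case=> [|n]; first by move=> x; exact: cvg_cst.
  move=> x; apply/cvgrPdist_lt => e e0.
  have : \forall y \near x, mdist x y < e / n.+1%:R.
    apply/metricType_numDomainType.nbhs_mdistP; exists (e / n.+1%:R) => //=.
    exact: divr_gt0.
  apply: filterS => y; rewrite ltr_pdivlMr// mulrC => xy.
  have n1 : n%:R * mdist x y <= n.+1%:R * mdist x y.
    by rewrite ler_wpM2r ?mdist_ge0// ler_nat.
  have := Glip n x y; have := Glip n y x; rewrite (metric_sym y).
  rewrite ltr_norml => ? ?; apply/andP; split; lra.
- case=> [|n] x; first exact: leG (fun y => Slb 0%N x _ (ex_intro2 _ _ y I erefl)).
  apply: leG => y; apply: le_trans (Gle n x y) _.
  by rewrite lerD2l ler_wpM2r ?mdist_ge0// ler_nat.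
- by case.
- move=> x; rewrite -cvg_shiftS /=; apply/cvgrPdist_le => e e0.
  have /metricType_numDomainType.nbhs_mdistP[r /= r0 hr] := lsc_near x lsca e0.
  (* Outside the ball of radius [r] the penalty alone exceeds [a x]; inside it, semicontinuity gives
     the bound. *)
  near=> n; have anr : a x <= n%:R * r.
    rewrite -ler_pdivrMr//; near: n; exact: nbhs_infty_ger.
  rewrite ler_norml; apply/andP; split; first by have := Ga n x; lra.
  suff : a x - e <= G n x by lra.
  apply: leG => y; have [xy|xy] := ltP (mdist x y) r.
    apply: le_trans (ltW (hr _ xy)) _; by rewrite lerDl mulr_ge0// mdist_ge0.
  have : n%:R * r <= n%:R * mdist x y by rewrite ler_wpM2l.
  have := a0 y; lra.
Unshelve. all: by end_near. Qed.

Lemma cvg_complex (T : Type) (F : set_system T) {FF : Filter F}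
    (p q : T -> R) (b c : R) : p @ F --> b -> q @ F --> c ->
  (fun t => (p t +i* q t)%C : R[i]^o) @ F --> ((b +i* c)%C : R[i]^o).
Proof.
move=> /cvgrPdist_lt pb /cvgrPdist_lt qc; apply/cvg_normcP => e e0.
have e20 : 0 < e / 2 by rewrite divr_gt0.
apply: filterS2 (pb _ e20) (qc _ e20) => t pt qt.
by apply: le_lt_trans (normc_le _) _; rewrite /= [e]splitr ltrD.
Qed.

(** The increments of the four monotone approximations are nonnegative, so the moduli of the
    differences telescope to at most [a1 + a2 + a3 + a4]. *)
Lemma D_norm_le g (a1 a2 a3 a4 : K -> R) (M : R) : 0 <= M ->
  (forall x, [/\ 0 <= a1 x, 0 <= a2 x, 0 <= a3 x & 0 <= a4 x]) ->
  lower_semicontinuous (EFin \o a1) -> lower_semicontinuous (EFin \o a2) ->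
  lower_semicontinuous (EFin \o a3) -> lower_semicontinuous (EFin \o a4) ->
  (forall x, a1 x + a2 x + (a3 x + a4 x) <= M) ->
  (forall x, g x = ((a1 x - a2 x) +i* (a3 x - a4 x))%C) ->
  (D_norm g <= M%:E)%E.
Proof.
move=> M0 apos l1 l2 l3 l4 aM gE.
have [F1 [F10 F1c F1m F1a F1l]] :=
  lsc_sup_continuous (fun x => let: And4 h _ _ _ := apos x in h) l1.
have [F2 [F20 F2c F2m F2a F2l]] :=
  lsc_sup_continuous (fun x => let: And4 _ h _ _ := apos x in h) l2.
have [F3 [F30 F3c F3m F3a F3l]] :=
  lsc_sup_continuous (fun x => let: And4 _ _ h _ := apos x in h) l3.
have [F4 [F40 F4c F4m F4a F4l]] :=
  lsc_sup_continuous (fun x => let: And4 _ _ _ h := apos x in h) l4.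
pose S n x : R[i] := ((F1 n x - F2 n x) +i* (F3 n x - F4 n x))%C.
pose phi n x : R[i]^o := S n.+1 x - S n x.
have S0 x : S 0%N x = 0 by rewrite /S F10 F20 F30 F40 !subrr.
have phiS x n : series (phi^~ x) n = S n x.
  by rewrite /series /= telescope_sumr// S0 subr0.
have Ssup : (abs_series_sup phi <= M%:E)%E.
  apply/esup0_le; split=> // x; apply/nneseries_le => [j|n]; first exact: normc_ge0.
  apply: le_trans (aM x); apply: (@le_trans _ _ (F1 n x + F2 n x + (F3 n x + F4 n x))).
    pose G j := F1 j x + F2 j x + (F3 j x + F4 j x).
    apply: (@le_trans _ _ (\sum_(0 <= j < n) (G j.+1 - G j))).
      apply: ler_sum => j _; apply: le_trans (normc_le _) _; rewrite /=.
      have := F1m j x; have := F2m j x; have := F3m j x; have := F4m j x.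
      move=> ? ? ? ?; apply: (@le_trans _ _
        ((F1 j.+1 x - F1 j x + (F2 j.+1 x - F2 j x)) +
         (F3 j.+1 x - F3 j x + (F4 j.+1 x - F4 j x)))); last by rewrite /G; lra.
      by rewrite lerD// ler_norml; apply/andP; split; lra.
    by rewrite telescope_sumr// /G F10 F20 F30 F40 !addr0 subr0.
  by rewrite !lerD.
apply: (le_trans _ Ssup); apply: ereal_inf_lbound; exists phi => //; split.
- have Sc n : continuous (S n : K -> R[i]^o).
    move=> x; apply: cvg_complex; apply: cvgB;
    by [exact: F1c|exact: F2c|exact: F3c|exact: F4c].
  by move=> j x; apply: (@cvgB _ R[i]^o); exact: Sc.
- by apply: le_lt_trans Ssup _; exact: ltry.
- move=> x; rewrite (funext (phiS x)) gE.
  by apply: cvg_complex; apply: cvgB.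
Qed.

End Semicontinuous.

(** * Approximation by simple D-functions *)

Section Approximation.
Context {R : realType} {K : metricType R}.
Implicit Types (a b r u : K -> R) (f g : K -> R[i]^o).

Definition simple_lsc b : Prop :=
  [/\ finite_set (range b), bounded_lsc b & forall x, 0 <= b x].

(** [b x] is the largest grid value below [a] on a neighbourhood of [x], a condition open in [x],
    hence lower semicontinuous. One [d] is lost to the failure of semicontinuity of [a], one to
    rounding. *)
Lemma lsc_quantize a (d M : R) : 0 < d -> (forall x, 0 <= a x <= M) ->
  (forall x, \forall y \near x, a x - d <= a y) ->
  exists2 b, simple_lsc b & forall x, a x - 2 * d <= b x <= a x.
Proof.
move=> d0 aM ad.
pose U (x : K) (n : nat) : Prop := \forall y \near x, d *+ n <= a y.
have Ua x n : U x n -> d *+ n <= a x by move=> /nbhs_singleton.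
have exU x : exists n, `[< U x n >].
  by exists 0%N; apply/asboolP; apply: nearW => y; rewrite mulr0n; case/andP: (aM y).
have ubU x n : `[< U x n >] -> (n <= Num.truncn (M / d))%N.
  move=> /asboolP/Ua da; case/andP: (aM x) => a0 axM.
  rewrite truncn_ge_nat; last exact: divr_ge0 (le_trans a0 axM) (ltW d0).
  by rewrite ler_pdivlMr// mulr_natl (le_trans da).
pose v x := ex_maxn (exU x) (@ubU x).
have vU x : U x (v x) by rewrite /v; case: ex_maxnP => n /asboolP.
have Uv x n : U x n -> (n <= v x)%N.
  by rewrite /v; case: ex_maxnP => m _ h Un; apply: h; apply/asboolP.
have v0 x : 0 <= d *+ v x by rewrite mulrn_wge0// ltW.
exists (fun x => d *+ v x); last first.
  move=> x; rewrite (Ua _ _ (vU x)) andbT.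
  have [n nE] : exists n, n = Num.truncn (a x / d) by eexists.
  have : d *+ n <= a x < d *+ n.+1.
    have := truncn_itv (divr_ge0 (proj1 (andP (aM x))) (ltW d0)).
    by rewrite -nE ler_pdivlMr// ltr_pdivrMr// !mulr_natl.
  (* One grid step below the rounded value of [a x], the bound survives near [x] because [a] drops
     by at most [d] there. At [n = 0] there is no lower step, but then [a x < d]. *)
  case: n {nE} => [|n] /andP[na an].
    by move: an (v0 x); rewrite mulr1n; lra.
  suff /Uv nv : U x n.
    have : d *+ n <= d *+ v x by apply: ler_wpMn2l nv; exact: ltW.
    by move: an; rewrite !mulrSr; lra.
  by apply: filterS (ad x) => y; move: na; rewrite mulrSr; lra.
split=> //; last split.
- apply: (@sub_finite_set _ _ [set d *+ k | k in `I_(Num.truncn (M / d)).+1]).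
    move=> _ [x _ <-]; exists (v x) => //=; rewrite ltnS.
    exact: (ubU x _ (asboolT (vU x))).
  exact: finite_image (finite_II _).
- exists M; split; first exact: num_real.
  move=> c Mc x _ /=; rewrite ger0_norm//; apply: le_trans (ltW Mc).
  by apply: le_trans (Ua _ _ (vU x)) _; case/andP: (aM x).
- move=> x t; rewrite /= lte_fin => tx.
  exists [set y | U y (v x)]; first exact: near_join (vU x).
  move=> y /Uv vxy; rewrite lte_fin; apply: lt_le_trans tx _.
  by apply: ler_wpMn2l vxy; exact: ltW.
Qed.

(** [u] absorbs jumps of [r] of either sign, so both halves are nearly lower semicontinuous; [M] and
    [beta] make them nonnegative. Both rounding errors are one-sided, so their difference is still
    at most [2 * d]. *)
Lemma simple_lsc_difference u r (d M beta : R) : 0 < d ->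
  (forall x, `|r x| <= M) -> (forall x, 0 <= u x <= beta) ->
  (forall x, \forall y \near x, u y + `|r y - r x| <= u x + d) ->
  exists b1 b2, [/\ simple_lsc b1, simple_lsc b2,
    forall x, `|r x - (b1 x - b2 x)| <= 2 * d &
    forall x, b1 x + b2 x <= M + beta].
Proof.
move=> d0 rM ub ud.
have r2 x : - M <= r x <= M by rewrite -ler_norml.
have [||b1 sb1 b1E] := @lsc_quantize (fun x => (M + beta - u x + r x) / 2) d (M + beta) d0.
- by move=> x; have := r2 x; have := ub x; lra.
- move=> x; apply: filterS (ud x) => y.
  by have := ler_norm (r x - r y); rewrite distrC; lra.
have [||b2 sb2 b2E] := @lsc_quantize (fun x => (M + beta - u x - r x) / 2) d (M + beta) d0.
- by move=> x; have := r2 x; have := ub x; lra.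
- move=> x; apply: filterS (ud x) => y.
  by have := ler_norm (r y - r x); lra.
exists b1, b2; split => // x; last by have := b1E x; have := b2E x; have := ub x; lra.
rewrite ler_norml; have := b1E x; have := b2E x; lra.
Qed.

Lemma simple_lsc_D (b1 b2 b3 b4 : K -> R) (M : R) : 0 <= M ->
  simple_lsc b1 -> simple_lsc b2 -> simple_lsc b3 -> simple_lsc b4 ->
  (forall x, b1 x + b2 x + (b3 x + b4 x) <= M) ->
  let g : K -> R[i]^o := fun x => ((b1 x - b2 x) +i* (b3 x - b4 x))%C in
  simple_D_fun g /\ (D_norm g <= M%:E)%E.
Proof.
move=> M0 [f1 l1 p1] [f2 l2 p2] [f3 l3 p3] [f4 l4 p4] bM g; split; last first.
  by apply: (D_norm_le M0 (a1 := b1) (a2 := b2) (a3 := b3) (a4 := b4)) => //;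
     [case: l1|case: l2|case: l3|case: l4].
split; first by exists b1, b2, b3, b4.
pose h (p : (R * R) * (R * R)) : R[i]^o := ((p.1.1 - p.1.2) +i* (p.2.1 - p.2.2))%C.
apply: (@sub_finite_set _ _ (h @` ((range b1 `*` range b2) `*` (range b3 `*` range b4)))).
  by move=> _ [x _ <-]; exists ((b1 x, b2 x), (b3 x, b4 x)).
by apply: finite_image; do !apply: finite_setX.
Qed.

(** One potential serves both the real and the imaginary part, as each jumps by no more than [f].
    Each part costs [M + beta], whence the factor 2, absent for real [f]. *)
Lemma simple_D_approx f (M beta d : R) : 0 <= M -> 0 <= beta ->
  (forall x, normc (f x) <= M) -> osc_bound f beta -> 0 < d ->
  exists g, [/\ simple_D_fun g, (D_norm g <= (2 * (M + beta))%:E)%E,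
    (forall x, complex.Im (f x) = 0) -> (D_norm g <= (M + beta)%:E)%E &
    forall x, normc (f x - g x) <= d].
Proof.
(* Each part is approximated within [2 * (d / 4)], and the two errors add up to [d]. *)
move=> M0 beta0 fM fb d0; have d40 : 0 < d / 4 by rewrite divr_gt0.
have [u uP] := oscillation_potential fb d40.
have ub x : 0 <= u x <= beta by case: (uP x).
have [||b1 [b2 [sb1 sb2 b12 b12M]]] :=
    @simple_lsc_difference u (fun x => complex.Re (f x)) (d / 4) M beta d40 _ ub _.
- by move=> x; apply: le_trans (normc_Re _) (fM x).
- move=> x; have [_] := uP x; apply: filterS => y; apply: le_trans.
  by rewrite lerD2l -raddfB; exact: normc_Re.
have [||b3 [b4 [sb3 sb4 b34 b34M]]] :=
    @simple_lsc_difference u (fun x => complex.Im (f x)) (d / 4) M beta d40 _ ub _.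
- by move=> x; apply: le_trans (normc_Im _) (fM x).
- move=> x; have [_] := uP x; apply: filterS => y; apply: le_trans.
  by rewrite lerD2l -raddfB; exact: normc_Im.
have [fR|fR] := pselect (forall x, complex.Im (f x) = 0).
  have s0 : simple_lsc (fun=> 0).
    split=> //; first by apply: (@sub_finite_set _ _ [set 0]) => // _ [x _ <-].
    split; first exact: bounded_cst.
    by move=> x t t0; exists setT => //; exact: filterT.
  have [|] := @simple_lsc_D b1 b2 (fun=> 0) (fun=> 0) (M + beta)
    (addr_ge0 M0 beta0) sb1 sb2 s0 s0.
    by move=> x; rewrite !addr0.
  set g := fun x => _ => Dg gM; exists g; split => //.
    by apply: le_trans gM _; rewrite lee_fin; lra.
  move=> x; apply: le_trans (normc_sub_le _ _ _) _.
  rewrite fR !subr0 normr0 addr0; apply: le_trans (b12 x) _; lra.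
have [||] := @simple_lsc_D b1 b2 b3 b4 (2 * (M + beta)) _ sb1 sb2 sb3 sb4.
- by rewrite mulr_ge0// addr_ge0.
- by move=> x; have := b12M x; have := b34M x; lra.
set g := fun x => _ => Dg gM; exists g; split => //.
move=> x; apply: le_trans (normc_sub_le _ _ _) _.
have := b12 x; have := b34 x; lra.
Qed.

Lemma simple_D_sequence f (L : R) :
  (forall d, 0 < d -> exists g, [/\ simple_D_fun g, (D_norm g <= L%:E)%E &
    forall x, normc (f x - g x) <= d]) ->
  exists phi : nat -> K -> R[i]^o, [/\ forall n, simple_D_fun (phi n),
    {uniform, phi @ \oo --> f} & forall n, (D_norm (phi n) <= L%:E)%E].
Proof.
move=> h; have /choice[phi phiP] : forall n : nat, exists g, [/\ simple_D_fun g,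
    (D_norm g <= L%:E)%E & forall x, normc (f x - g x) <= n.+1%:R^-1].
  by move=> n; apply: h; rewrite invr_gt0.
exists phi; split => [n||n]; [by case: (phiP n)| |by case: (phiP n)].
apply/uniform_normcP => e e0; near=> n => x.
have [_ _ /(_ x)/le_lt_trans] := phiP n; apply.
near: n; exact: near_infty_natSinv_lt (PosNum e0).
Unshelve. all: by end_near. Qed.

End Approximation.

(** * The equivalences and the least oscillation constant *)

Section Equivalence.
Context {R : realType} {K : metricType R}.
Implicit Types (f : K -> R[i]^o).

Lemma bounded_normc f : bounded_fun f ->
  exists2 M : R, 0 <= M & forall x, normc (f x) <= M.
Proof.
move=> [m [/complex_realP[k ->] fk]]; exists (`|k| + 1); first by rewrite addr_ge0.
move=> x; have /fk/(_ x I) : k%:C%C < (`|k| + 1)%:C%C.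
  by rewrite ltcR; apply: le_lt_trans (ler_norm k) _; rewrite ltrDl.
by rewrite /= normr_normc lecR.
Qed.

Lemma osc_bound_simple_D f (lambda : R) : bounded_fun f -> osc_bound f lambda ->
  exists (L : R) (phi : nat -> K -> R[i]^o), [/\ forall n, simple_D_fun (phi n),
    {uniform, phi @ \oo --> f} & forall n, (D_norm (phi n) <= L%:E)%E].
Proof.
(* On an empty space [lambda] may be negative; its absolute value is a nonnegative bound in all
   cases. *)
move=> /bounded_normc[M M0 fM] fl; exists (2 * (M + `|lambda|)).
apply: simple_D_sequence => d d0.
have fl' : osc_bound f `|lambda|.
  by move=> n eps n1 eps0 ne; apply: le_trans (ler_norm _); exact: fl.
have [g [Dg gL _ fg]] := simple_D_approx M0 (normr_ge0 lambda) fM fl' d0.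
by exists g.
Qed.

Lemma osc_bound_B14_bound f (M beta : R) : 0 <= M -> 0 <= beta ->
  (forall x, normc (f x) <= M) -> (forall x, complex.Im (f x) = 0) ->
  osc_bound f beta -> B14_bound f (M + beta).
Proof.
move=> M0 beta0 fM fR fb.
have [d d0|phi [Dphi phif phiM]] := @simple_D_sequence R K f (M + beta).
  have [g [Dg _ gM fg]] := simple_D_approx M0 beta0 fM fb d0.
  by exists g; split => //; exact: gM.
by exists phi; split => // n; case: (Dphi n).
Qed.

(** The infimum is attained: each admissible sum is a lower bound of the set of constants. *)
Lemma osc_bound_inf f : (exists lambda : R, osc_bound f lambda) ->
  osc_bound f (inf [set lambda : R | osc_bound f lambda]).
Proof.
move=> fl n eps n1 eps0 ne; apply: lb_le_inf => // lambda; exact.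
Qed.

(* On an empty space every real number is a bound, and [inf] takes its junk
   value. *)
Lemma inf_osc_bound_empty f : ~ ([set: K] !=set0) ->
  inf [set lambda : R | osc_bound f lambda] = 0.
Proof.
move=> K0; rewrite inf_out// => -[_ [l]] /(_ (l - 1)) h.
suff /h : osc_bound f (l - 1) by lra.
by move=> n eps _ _ [x _]; case: K0; exists x.
Qed.

Lemma inf_osc_bound_ge0 f : (exists lambda : R, osc_bound f lambda) ->
  0 <= inf [set lambda : R | osc_bound f lambda].
Proof.
move=> fl; have [[x _]|/inf_osc_bound_empty ->//] := pselect ([set: K] !=set0).
by apply: lb_le_inf => // lambda; exact: osc_bound_ge0.
Qed.

Lemma inf_osc_bound_le f (lambda : R) : 0 <= lambda -> osc_bound f lambda ->
  inf [set l : R | osc_bound f l] <= lambda.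
Proof.
move=> l0 fl; have [[x _]|/inf_osc_bound_empty ->//] := pselect ([set: K] !=set0).
by apply: ge_inf => //; exists 0 => l; exact: osc_bound_ge0.
Qed.

End Equivalence.

Theorem theorem2 (R : realType) (K : metricType R) (f : K -> R[i]^o) :
  bounded_fun f ->
  [/\ B14 f <->
        (exists phi : nat -> K -> R[i]^o,
          [/\ forall n, simple_D_fun (phi n),
              {uniform, phi @ \oo --> f} &
              (ereal_sup (range (fun n => D_norm (phi n))) < +oo)%E]),
      B14 f <-> (exists lambda : R, osc_bound f lambda) &
      (forall x, complex.Im (f x) = 0) -> B14 f ->
        let beta := inf [set lambda : R | osc_bound f lambda] in
        [/\ osc_bound f beta,
            ((2^-1)%:E * (sup_norm f + beta%:E) <= B14_norm f)%E &
            (B14_norm f <= sup_norm f + 3%:E * beta%:E)%E]].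
Proof.
move=> fbd.
have B14_osc : B14 f -> exists lambda : R, osc_bound f lambda.
  by move=> [lambda /B14_bound_osc_bound fl]; exists lambda.
split.
- split=> [/B14_osc[lambda /(osc_bound_simple_D fbd)[L [phi [Dphi phif phiL]]]]|].
    exists phi; split => //; apply: (@le_lt_trans _ _ L%:E); last exact: ltry.
    by apply: ge_ereal_sup => _ [n _ <-].
  move=> [phi [Dphi phif]]; set s := ereal_sup _ => soo.
  have phis n : (D_norm (phi n) <= s)%E by apply: ereal_sup_ubound; exists n.
  have sfin : s \is a fin_num.
    by rewrite ge0_fin_numE//; apply: le_trans (phis 0%N); exact: D_norm_ge0.
  exists (fine s), phi; split => // n; first by case: (Dphi n).
  by rewrite fineK.
- split=> // -[lambda /(osc_bound_simple_D fbd)[L [phi [Dphi phif phiL]]]].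
  by exists L, phi; split => // n; case: (Dphi n).
- move=> fR /[dup] fB /B14_osc fl beta.
  have beta0 : 0 <= beta := inf_osc_bound_ge0 fl.
  have fbeta : osc_bound f beta := osc_bound_inf fl.
  have [M M0 fM] := bounded_normc fbd.
  have sE : sup_norm f = (fine (sup_norm f))%:E.
    rewrite fineK// ge0_fin_numE; last by apply: ereal_sup_ubound; left.
    by apply: (@le_lt_trans _ _ M%:E); [apply/esup0_le|exact: ltry].
  have /esup0_le[s0 fs] : (sup_norm f <= (fine (sup_norm f))%:E)%E by rewrite -sE.
  split => //.
    (* Every [lambda] in the infimum dominates both [beta] and the sup norm, hence their average. *)
    apply: le_ereal_inf_tmp => _ [lambda fla <-]; have la0 := B14_bound_ge0 fla.
    have beta_la := inf_osc_bound_le la0 (B14_bound_osc_bound fla).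
    have s_la : fine (sup_norm f) <= lambda.
      rewrite -lee_fin -sE; apply/esup0_le; split => // x.
      by rewrite lee_fin; exact: B14_bound_normc fla.
    rewrite sE -EFinD -EFinM lee_fin; rewrite -/beta in beta_la; lra.
  (* The sharper bound with [beta] in place of [3 * beta] is proved first; [beta0] gives the
     rest. *)
  apply: (@le_trans _ _ (fine (sup_norm f) + beta)%:E).
    apply: ereal_inf_lbound; exists (fine (sup_norm f) + beta) => //.
    by apply: osc_bound_B14_bound => // x; rewrite -lee_fin; exact: fs.
  by rewrite [in leRHS]sE -EFinM -EFinD lee_fin; lra.
Qed.
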